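(* Let $M$ be a finite $C$-algebra with $T,F,U$ such that $|M| > 3$ and $T$ is an atom of $M$. Then $M$ is not atomic.
   Context: A $C$-algebra is an algebra $\langle M,\vee,\wedge,\neg\rangle$ of type $(2,2,1)$ satisfying, for all $\alpha,\beta,\gamma$: $\neg\neg\alpha=\alpha$; $\neg(\alpha\wedge\beta)=\neg\alpha\vee\neg\beta$; $(\alpha\wedge\beta)\wedge\gamma=\alpha\wedge(\beta\wedge\gamma)$; $\alpha\wedge(\beta\vee\gamma)=(\alpha\wedge\beta)\vee(\alpha\wedge\gamma)$; $(\alpha\vee\beta)\wedge\gamma=(\alpha\wedge\gamma)\vee(\neg\alpha\wedge\beta\wedge\gamma)$; $\alpha\vee(\alpha\wedge\beta)=\alpha$; $(\alpha\wedge\beta)\vee(\beta\wedge\alpha)=(\beta\wedge\alpha)\vee(\alpha\wedge\beta)$. A $C$-algebra with $T,F,U$ has nullary operations $T,F,U$: $T$ is the two-sided identity for $\wedge$, $F$ the two-sided identity for $\vee$, $U$ the fixed point of $\neg$. Order: $a\leq b$ iff $a\vee b=b$. An atom is $a\neq F$ such that every $b$ with $F\leq b\leq a$, $b\neq a$ equals $F$. For finitely many atoms $a_1,\dots,a_N$: if $a_{\sigma(1)}\vee\cdots\vee a_{\sigma(N)}=a_1\vee\cdots\vee a_N$ for every bijection $\sigma$ of $\{1,\dots,N\}$, then $\bigoplus_{i=1}^N a_i$ exists and equals this value. $M$ is atomic if every $a\neq F$ in $M$ equals $\bigoplus_{i=1}^N a_i$ for some finite set of atoms $\{a_1,\dots,a_N\}$.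 *)

(* Defs.v *)
From HB Require Import structures.
From mathcomp Require Import all_boot all_fingroup.

Set Implicit Arguments.
Unset Strict Implicit.
Unset Printing Implicit Defensive.

HB.mixin Record isCAlgebra (M : Type) := {
  cor : M -> M -> M;
  cand : M -> M -> M;
  cneg : M -> M;
  cnegK : forall a, cneg (cneg a) = a;
  cneg_and : forall a b, cneg (cand a b) = cor (cneg a) (cneg b);
  candA : forall a b c, cand (cand a b) c = cand a (cand b c);
  cand_orr : forall a b c, cand a (cor b c) = cor (cand a b) (cand a c);
  cand_orl : forall a b c,
    cand (cor a b) c = cor (cand a c) (cand (cneg a) (cand b c));
  cor_andK : forall a b, cor a (cand a b) = a;
  cor_andC : forall a b,
    cor (cand a b) (cand b a) = cor (cand b a) (cand a b)
}.

#[short(type="cAlgType")]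
HB.structure Definition CAlgebra := { M of isCAlgebra M }.

HB.mixin Record CAlgebra_hasTFU (M : Type) of CAlgebra M := {
  cT : M;
  cF : M;
  cU : M;
  candTx : forall a : M, cand cT a = a;
  candxT : forall a : M, cand a cT = a;
  corFx : forall a : M, cor cF a = a;
  corxF : forall a : M, cor a cF = a;
  cnegU : cneg cU = cU :> M
}.

#[short(type="cAlgTFUType")]
HB.structure Definition CAlgebraTFU := { M of CAlgebra M & CAlgebra_hasTFU M }.

#[short(type="finCAlgTFUType")]
HB.structure Definition FinCAlgebraTFU := { M of Finite M & CAlgebraTFU M }.

Arguments cT {_}.
Arguments cF {_}.
Arguments cU {_}.

Definition cle (M : cAlgType) (a b : M) : Prop := cor a b = b.

Definition atom (M : cAlgTFUType) (a : M) : Prop :=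
  a <> cF /\ forall b : M, cle cF b -> cle b a -> b <> a -> b = cF.

(* [cor] is not commutative, so the order of the indices matters.  It is      *)
(* associative with two-sided identity [cF], so the right-nested bigop is the *)
(* unparenthesized a_1 \/ ... \/ a_N; the empty join is [cF].                 *)
Definition cjoin (M : cAlgTFUType) (N : nat) (a : 'I_N -> M) : M :=
  \big[cor/cF]_(i < N) a i.

(* The partial operation (+)_{i=1}^N a_i, given by its graph. *)
Definition is_oplus (M : cAlgTFUType) (N : nat) (a : 'I_N -> M) (x : M) : Prop :=
  [/\ forall i, atom (a i),
      forall s : 'S_N, cjoin (fun i => a (s i)) = cjoin a
    & x = cjoin a].

(* Injectivity of [a] says that a_1, ..., a_N list a set without repetition.  *)
(* N = 0 is harmless here: it would force x = cF.                             *)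
Definition atomic (M : cAlgTFUType) : Prop :=
  forall x : M, x <> cF ->
    exists (N : nat) (a : 'I_N -> M), injective a /\ is_oplus a x.

(* Main.v *)
(** An atom [a] other than [T] satisfies [a /\ F = a]: always [a /\ F <= a], and
    if [a /\ F = F] then [a <= T], so [a = T] because [T] is an atom.  This
    identity passes to joins, while a permutation-invariant join containing [T]
    equals [T].  Hence, if [M] is atomic, every [x] other than [T] and [F]
    satisfies [x /\ F = x], and so does its negation; this forces [x = U], so
    [M] has at most 3 elements. *)
Require Import Defs.
From HB Require Import structures.
From mathcomp Require Import all_boot all_fingroup.

Section CAlgebraTFUTheory.
Variable M : cAlgTFUType.
Implicit Types a b x : M.

Lemma cneg_or a b : cneg (cor a b) = cand (cneg a) (cneg b).
Proof. by rewrite -[RHS]cnegK cneg_and !cnegK. Qed.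

Lemma cnegT : cneg cT = cF :> M.
Proof.
by rewrite -[LHS]corxF -[cF in LHS]cnegK -cneg_and candTx cnegK.
Qed.

Lemma cnegF : cneg cF = cT :> M.
Proof. by rewrite -cnegT cnegK. Qed.

Lemma candFx a : cand cF a = cF.
Proof. by rewrite -[LHS]corFx cor_andK. Qed.

Lemma corTx a : cor cT a = cT.
Proof. by rewrite -[LHS]cnegK cneg_or cnegT candFx cnegF. Qed.

(** Expand [cand (cor a b) cT] by left distributivity. *)
Lemma cor_negand a b : cor a (cand (cneg a) b) = cor a b.
Proof. by rewrite -[RHS]candxT cand_orl !candxT. Qed.

Lemma corxT a : cor a cT = cor a (cneg a).
Proof. by rewrite -cor_negand candxT. Qed.

Lemma candxF a : cand a cF = cand a (cneg a).
Proof.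
by rewrite -[LHS]cnegK cneg_and cnegF corxT cneg_or !cnegK.
Qed.

Lemma candxF_le a : cle (cand a cF) a.
Proof. by rewrite /cle -{2}[a]candxT -cand_orr corFx candxT. Qed.

(** Negating the hypothesis gives ¬a \/ T = T; distributing (¬a \/ T) /\ F then yields ¬a /\ F = F,
    whose negation is the claim. *)
Lemma candxF_leT a : cand a cF = cF -> cle a cT.
Proof.
move=> aF.
have naT : cor (cneg a) cT = cT by rewrite -{1}cnegF -cneg_and aF cnegF.
have naF : cand (cneg a) cF = cF.
  have := cand_orl (cneg a) cT cF.
  by rewrite naT !candTx cnegK aF corxF => <-.
by rewrite /cle -[LHS]cnegK cneg_or cnegT naF cnegF.
Qed.

Lemma corF_absorb a b :
  cand a cF = a -> cand b cF = b -> cand (cor a b) cF = cor a b.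
Proof. by move=> aF bF; rewrite cand_orl aF bF cor_negand. Qed.

Lemma candF_absorb_U x :
  cand x cF = x -> cand (cneg x) cF = cneg x -> x = cU.
Proof.
move=> xF nxF.
(* An element fixed by [/\ F] is a left zero of [/\], since F is one. Here x, ¬x and U are left
   zeros of both operations, so [cor_andC] identifies x first with ¬x, then with U. *)
have and_absorb a b : cand a cF = a -> cand a b = a.
  by move=> aF; rewrite -aF candA candFx.
have or_absorb a b : cand (cneg a) cF = cneg a -> cor a b = a.
  by move=> aF; rewrite -[LHS]cnegK cneg_or and_absorb // cnegK.
have nx : x = cneg x.
  have := cor_andC x (cneg x).
  rewrite (and_absorb x) // (and_absorb (cneg x)) //.
  by rewrite (or_absorb x) // (or_absorb (cneg x)) // cnegK.
have UU : cor cU cU = cU :> M by rewrite -{2}[cU]candxT cor_andK.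
have UF : cand cU cF = cU :> M.
  by rewrite candxF cnegU -[LHS]cnegK cneg_and cnegU UU cnegU.
have := cor_andC x cU; rewrite (and_absorb x) // (and_absorb cU) //.
by rewrite (or_absorb x) // (or_absorb cU) // cnegU.
Qed.

(** A transposition brings T to the front of the join, where it absorbs all that follows. *)
Lemma oplusT N (a : 'I_N -> M) x i : is_oplus a x -> a i = cT -> x = cT.
Proof.
case: N a i => [? [] //|N] a i [_ a_perm ->] ai.
by rewrite -(a_perm (tperm ord0 i)) /cjoin big_ord_recl tpermL ai corTx.
Qed.

End CAlgebraTFUTheory.

Lemma atom_candxF (M : finCAlgTFUType) (a : M) :
  atom (cT : M) -> atom a -> a <> cT -> cand a cF = a.
Proof.
move=> [_ Tmin] [aNF amin] aNT.
have [// | /eqP aFNa] := eqVneq (cand a cF) a.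
have aF : cand a cF = cF.
  by apply: amin => //; [exact: corFx | exact: candxF_le].
case: aNF; apply: Tmin => //; [exact: corFx | exact: candxF_leT].
Qed.

Theorem theorem2p48 (M : finCAlgTFUType) (card_M : 3 < #|M|)
  (atom_T : atom (cT : M)) : ~ atomic M.
Proof.
move=> Matomic.
have absorb (x : M) : x <> cF -> x <> cT -> cand x cF = x.
  move=> /Matomic[N [a [_ ax]]] xNT; have [a_atom _ ->] := ax.
  rewrite /cjoin; elim/big_ind: _ => [|b c|i _]; first exact: candFx.
    exact: corF_absorb.
  by apply: atom_candxF => // /(oplusT _ _ _ _ _ ax).
suff /subset_leq_card : [set: M] \subset [:: cT; cF; cU].
  rewrite cardsT => /leq_trans/(_ (card_size _)) /=.
  by rewrite leqNgt card_M.
apply/subsetP => x _; rewrite !inE.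
have [//|/eqP xNT] := eqVneq x cT; have [//|/eqP xNF] := eqVneq x cF.
apply/eqP/candF_absorb_U; apply: absorb => //.
  (* Negation swaps T and F, so ¬x also avoids both. *)
  by move/(congr1 cneg); rewrite cnegK cnegF.
by move/(congr1 cneg); rewrite cnegK cnegT.
Qed.
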